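(* Let $G\in\mathcal G$, $\lambda\ge 0$, and assume that $\lambda<M$ whenever $G^-(\lambda)<\rho$. Fix $\delta\in(0,1)$, let $N\ge1$ and $\zeta=\sqrt{\frac{\log(2/\delta)}{2N}}$. With probability at least $1-2\delta$ (over the $N$ i.i.d. demand samples from $G$), the algorithm RCN described in the context, run with confidence term $\zeta$, outputs an ordering quantity $q^{\mathrm{alg}}$ such that: (i) if $G^-(\lambda)\ge\rho+2\zeta$: $\ \mathrm{Regret}(q^{\mathrm{alg}})\le\Delta+\lambda(b+h)\zeta=\lambda(b+h)\zeta$; (ii) if $G^-(\lambda)\in[\rho,\rho+2\zeta)$: $\ \mathrm{Regret}(q^{\mathrm{alg}})\le\Delta+2\lambda(b+h)\zeta=2\lambda(b+h)\zeta$; (iii) if $G^-(\lambda)\in[\rho-2\zeta,\rho)$: $\ \mathrm{Regret}(q^{\mathrm{alg}})\le\Delta+2\max\{\tfrac bh,1\}(M-\lambda)(b+h)\zeta$; (iv) if $G^-(\lambda)<\rho-2\zeta$: $\ \mathrm{Regret}(q^{\mathrm{alg}})\le\Delta+\max\{\tfrac bh,1\}(M-\lambda)(b+h)\zeta$.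
   Context: Fix costs $b,h>0$, let $\rho=\frac{b}{b+h}\in(0,1)$, and let $M\ge 0$ be a finite constant. For a cdf $F$ of a nonnegative random variable $D$ (demand) with $\mathbb E_F[D]<\infty$ and $q\ge 0$, the newsvendor cost is $C_F(q)=\mathbb E_F[b(D-q)^+ + h(q-D)^+]$, and $q^\star_F=\inf\{q : F(q)\ge\rho\}$. Let $\mathcal G=\{F : F \text{ has nonnegative support},\ \mathbb E_F[D]<\infty,\ q^\star_F\le M\}$. For $G\in\mathcal G$ and $\lambda\ge 0$: $G^-(\lambda)=\mathbb P_G(D<\lambda)$; $\mathcal F(\lambda;G)=\{F\in\mathcal G : F(x)=G(x)\ \forall x<\lambda\}$; $\mathrm{Regret}(q)=\sup_{F\in\mathcal F(\lambda;G)}\{C_F(q)-C_F(q^\star_F)\}$; the minimax risk is $\Delta=\inf_{q\in[0,M]}\mathrm{Regret}(q)$. Data: $d_1,\dots,d_N$ are i.i.d. from $G$; only the censored samples $s_i=\min\{d_i,\lambda\}$, $i=1,\dots,N$, are observed. Algorithm RCN with confidence term $\zeta$: compute $\widehat G^-(\lambda)=\frac1N\sum_{i=1}^N\mathbf 1\{s_i<\lambda\}$ and $\widehat G(x)=\frac1N\sum_{i=1}^N\mathbf 1\{s_i\le x\}$. - If $\widehat G^-(\lambda)\ge\rho+\zeta$, output $q^{\mathrm{alg}}=\inf\{x:\widehat G(x)\ge\rho\}$. - Else if $\widehat G^-(\lambda)<\rho-\zeta$, output $q^{\mathrm{alg}}=\frac{bM+h\lambda-(b+h)\widehat G^-(\lambda)M}{(b+h)(1-\widehat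 G^-(\lambda))}$. - Otherwise output $q^{\mathrm{alg}}=\lambda$. *)

(* Defs.v *)
(* Libraries: Mathematical Components and MathComp-Analysis. *)
From HB Require Import structures.
From mathcomp Require Import all_boot all_order all_algebra.
From mathcomp Require Import all_classical all_reals all_analysis.
Set Implicit Arguments.
Unset Strict Implicit.
Unset Printing Implicit Defensive.
Import Order.TTheory GRing.Theory Num.Theory.
Import numFieldNormedType.Exports.
Local Open Scope classical_set_scope.
Local Open Scope ring_scope.

(* A demand distribution is given by its law, a Borel probability measure on
   the real line; the cdf F of the demand is then [cdf (demand F)], where the
   demand D is the identity random variable on (R, F). *)
Definition law (R : realType) := probability (measurableTypeR R) R.

Definition demand_id (R : realType) : measurableTypeR R -> R := idfun.

HB.instance Definition _ (R : realType) :=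
  @isMeasurableFun.Build _ _ (measurableTypeR R) R (@demand_id R)
    (@measurable_id _ (measurableTypeR R) setT).

Definition demand (R : realType) (F : law R) : {RV F >-> R} := @demand_id R.

Section newsvendor.
Context {R : realType}.
Variables b h M : R.
Implicit Types (F G : law R) (q lam : R).

Definition rho : R := b / (b + h).

Definition cost F q : \bar R :=
  'E_F[fun w => b * Num.max (demand F w - q) 0
              + h * Num.max (q - demand F w) 0].

Definition qstar F : R := inf [set q | (rho%:E <= cdf (demand F) q)%E].

(* The class of demand distributions; since the support is nonnegative, the
   expectation below is well defined, possibly +oo. *)
Definition admissible : set (law R) :=
  [set F : law R | [/\ F [set w | demand F w < 0] = 0%E,
               ('E_F[demand F] < +oo)%E &
               qstar F <= M]].

(* The left limit G^-(lam) of the cdf. *)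
Definition prob_below G lam : R := fine (G [set w | demand G w < lam]).

Definition ambiguity lam G : set (law R) :=
  [set F : law R | admissible F /\
           forall x, x < lam -> cdf (demand F) x = cdf (demand G) x].

Definition regret lam G q : \bar R :=
  ereal_sup [set (cost F q - cost F (qstar F))%E | F in ambiguity lam G].

Definition minimax_risk lam G : \bar R :=
  ereal_inf [set regret lam G q | q in `[0, M]].

Definition emp_below N (s : 'I_N -> R) lam : R :=
  N%:R^-1 * \sum_(i < N) (s i < lam)%R%:R.

Definition emp_cdf N (s : 'I_N -> R) (x : R) : R :=
  N%:R^-1 * \sum_(i < N) (s i <= x)%R%:R.

(* [s] are the censored samples, at most [lam]; in the first branch the set is
   nonempty when 0 < N, and it is bounded below because 0 < rho, so that [inf]
   is the genuine infimum. *)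
Definition rcn lam (zeta : R) N (s : 'I_N -> R) : R :=
  let g := emp_below s lam in
  if rho + zeta <= g then inf [set x | rho <= emp_cdf s x]
  else if g < rho - zeta then
    (b * M + h * lam - (b + h) * g * M) / ((b + h) * (1 - g))
  else lam.

End newsvendor.

Section iid.
Context {R : realType} {d : measure_display} {Omega : measurableType d}.
Variable P : probability Omega R.

Definition mutually_independent (I : finType) (X : I -> {RV P >-> R}) : Prop :=
  forall (J : {set I}) (A : I -> set R), (forall i, measurable (A i)) ->
    P (\bigcap_(i in [set` J]) (X i @^-1` A i))
    = (\prod_(i in J) P (X i @^-1` A i))%E.

Definition iid (I : finType) (X : I -> {RV P >-> R}) (G : law R) : Prop :=
  mutually_independent X /\
  forall (i : I) (A : set (measurableTypeR R)), measurable A ->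
    distribution P (X i) A = G A.

End iid.

(* Main.v *)
Require Import Defs.
From mathcomp Require Import all_boot all_order all_algebra.
From mathcomp Require Import all_classical all_reals all_analysis.
From mathcomp Require Import measurable_realfun ring lra.
Import Order.TTheory GRing.Theory Num.Theory.
Import numFieldNormedType.Exports.
Local Open Scope classical_set_scope.
Local Open Scope ring_scope.

(* Write F^- for the left limit of the cdf F.  For q <= q',
     C_F(q) - C_F(q') <= (q' - q) (b + h) (rho - F(q))      and
     C_F(q') - C_F(q) <= (q' - q) (b + h) (F^-(q') - rho),
   because the integrands satisfy these bounds pointwise.  All regret bounds
   follow from these two inequalities.  If G^-(lam) >= rho then every F in the
   ambiguity set has the quantile q*_G, which has regret 0.  If G^-(lam) < rho
   then moving the mass of G on [lam, +oo) to the single point M, respectively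
   lam, shows that the regret of q in [lam, M] is the maximum of
   (M - q) (b + h) (rho - G^-(lam)) and h (q - lam), and the second branch of
   the algorithm is the point equalizing both terms, with the empirical
   frequency in place of G^-(lam).
   On the probabilistic side no uniform bound on the empirical cdf is needed:
   Hoeffding's one-sided inequality for the four sets {x < lam}, {x >= lam},
   {x < q_(rho - zeta)} and {x > q_(rho + zeta)}, where q_a is the a-quantile of
   G, costs delta / 2 each, and controls G at the empirical rho-quantile. *)

Set Implicit Arguments.
Unset Strict Implicit.
Unset Printing Implicit Defensive.

(** * Distribution functions and quantiles *)

Section law_cdf.
Context {R : realType}.
Implicit Types (F G : law R) (x y a c : R).

Definition cdfr F x : R := fine (cdf (demand F) x).

(** [qstar] is the case a = [rho]; nearby levels control the empirical quantile. *)
Definition quantile F a : R := inf [set q | (a%:E <= cdf (demand F) q)%E].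

Lemma cdfrE F x : cdf (demand F) x = (cdfr F x)%:E.
Proof. by rewrite fineK// fin_num_measure. Qed.

Lemma law_itvE F x : F [set` `]-oo, x]] = (cdfr F x)%:E.
Proof. by rewrite -cdfrE. Qed.

Lemma prob_belowE F x : F [set w | demand F w < x] = (prob_below F x)%:E.
Proof.
rewrite fineK// fin_num_measure//.
by have := measurable_itv `]-oo, x[; rewrite set_itvE.
Qed.

Lemma cdfr_le F x y : x <= y -> cdfr F x <= cdfr F y.
Proof. by move=> xy; rewrite -lee_fin -!cdfrE; exact: cdf_nondecreasing. Qed.

Lemma cdfr_le1 F x : cdfr F x <= 1.
Proof. by rewrite -lee_fin -cdfrE; exact: cdf_le1. Qed.

Lemma measurable_ltr x : measurable [set w : measurableTypeR R | w < x].
Proof. by have := measurable_itv `]-oo, x[; rewrite set_itvE. Qed.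

Lemma prob_below_le_cdfr F x : prob_below F x <= cdfr F x.
Proof.
rewrite -lee_fin -law_itvE -prob_belowE; apply: le_measure; rewrite ?inE//.
  exact: measurable_ltr.
by move=> w /= /ltW; rewrite in_itv.
Qed.

Lemma cdfr_le_prob_below F x y : x < y -> cdfr F x <= prob_below F y.
Proof.
move=> xy; rewrite -lee_fin -law_itvE -prob_belowE; apply: le_measure; rewrite ?inE//.
  exact: measurable_ltr.
by move=> w /=; rewrite in_itv/= => /le_lt_trans; apply.
Qed.

(** The half-lines up to y - 1/(n+1) increase to the open half-line below y, so continuity of the
    measure from below applies. *)
Lemma prob_below_le F y c : (forall x, x < y -> cdfr F x <= c) ->
  prob_below F y <= c.
Proof.
move=> Fc; rewrite -lee_fin -prob_belowE.
pose A n := [set` `]-oo, y - n.+1%:R^-1]] : set (measurableTypeR R).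
have AE : [set w | demand F w < y] = \bigcup_n A n.
  apply/seteqP; split=> w /=.
    move=> /ltr_add_invr[n wy]; exists n => //=.
    by rewrite /A/= in_itv/= lerBrDr ltW.
  move=> [n _]; rewrite /A/= in_itv/= => /le_lt_trans; apply.
  by rewrite ltrBlDr ltrDl invr_gt0.
have nd : nondecreasing_seq A.
  move=> m n mn; apply/subsetPset => w; rewrite /A/= !in_itv/= => /le_trans; apply.
  by rewrite lerB// lef_pV2 ?posrE// ler_nat.
have mA n : measurable (A n) by exact: measurable_itv.
have := @nondecreasing_cvg_mu _ _ _ F A mA (bigcup_measurable (fun k _ => mA k)) nd.
rewrite -AE => /cvg_lim <-//; apply: lime_le.
  by apply: ereal_nondecreasing_is_cvgn => m n /nd /subsetPset AA; apply: le_measure; rewrite ?inE.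
by apply: nearW => n; have := Fc (y - n.+1%:R^-1); rewrite -lee_fin -law_itvE; apply;
  rewrite ltrBlDr ltrDl invr_gt0.
Qed.

Lemma prob_below_homo F x y : x <= y -> prob_below F x <= prob_below F y.
Proof.
move=> xy; apply: prob_below_le => z zx; apply: cdfr_le_prob_below.
exact: lt_le_trans xy.
Qed.

(** The constraint defining the ambiguity set stops strictly below [lam]; left limits carry it over
    to the mass below [lam]. *)
Lemma eq_prob_below F G y :
  (forall x, x < y -> cdf (demand F) x = cdf (demand G) x) ->
  prob_below F y = prob_below G y.
Proof.
move=> FG; have e x : x < y -> cdfr F x = cdfr G x by move=> /FG; rewrite /cdfr => ->.
apply/eqP; rewrite eq_le; apply/andP; split;
  apply: prob_below_le => x xy; [rewrite e//|rewrite -e//];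
  exact: cdfr_le_prob_below.
Qed.

Section quantile.
Variables (F : law R) (a : R).
Hypotheses (a0 : 0 < a) (a1 : a < 1).

Let S := [set q | (a%:E <= cdf (demand F) q)%E].

(** With the lower bound below, this makes [inf] a genuine infimum rather than a default value: [S]
    is nonempty since a < 1 and bounded below since a > 0. *)
Let S0 : S !=set0.
Proof.
have : \forall x \near +oo, a < cdfr F x.
  by apply: cvgr_gt a1; apply/fine_cvg; exact: cvg_cdfy1.
move=> [r [_ ax]]; exists (r + 1); rewrite /S/= cdfrE lee_fin ltW//.
by apply: ax; rewrite ltrDl.
Qed.

Let Slb : has_lbound S.
Proof.
have : \forall x \near -oo, cdfr F x < a.
  by apply: cvgr_lt a0; apply/fine_cvg; exact: cvg_cdfNy0.
move=> [r [_ ax]]; exists (r - 1) => x; rewrite /S/= cdfrE lee_fin => aFx.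
rewrite leNgt; apply/negP => xr.
have /ax : x < r by rewrite (lt_trans xr)// ltrBlDr ltrDl.
by rewrite ltNge aFx.
Qed.

Lemma quantile_le x : a <= cdfr F x -> quantile F a <= x.
Proof. by move=> ax; apply: ge_inf => //; rewrite /S/= cdfrE lee_fin. Qed.

Lemma cdfr_lt_quantile x : x < quantile F a -> cdfr F x < a.
Proof. by rewrite !ltNge; apply: contra; exact: quantile_le. Qed.

Lemma prob_below_quantile : prob_below F (quantile F a) <= a.
Proof. by apply: prob_below_le => x /cdfr_lt_quantile/ltW. Qed.

(** Right continuity: every x to the right of the infimum lies above a member of [S], and the bound
    passes to the limit. *)
Lemma le_cdfr_quantile : a <= cdfr F (quantile F a).
Proof.
have rc : cdfr F x @[x --> (quantile F a)^'+] --> cdfr F (quantile F a).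
  apply/fine_cvg; rewrite -cdfrE; exact: cdf_right_continuous.
rewrite -(cvg_lim _ rc)//; apply: limr_ge; first by apply/cvg_ex; exists (cdfr F (quantile F a)).
near=> x.
have qx : quantile F a < x by near: x; exact: nbhs_right_gt.
have [y ay yx] := inf_lt S0 qx.
by rewrite (le_trans _ (cdfr_le F (ltW yx)))// -lee_fin -cdfrE.
Unshelve. all: by end_near. Qed.

Lemma lt_quantile x : cdfr F x < a -> x < quantile F a.
Proof.
rewrite !ltNge; apply: contra => /(cdfr_le F); apply: le_trans.
exact: le_cdfr_quantile.
Qed.

Lemma quantile_le_below x : a <= prob_below F x -> quantile F a <= x.
Proof. by move=> ax; rewrite quantile_le// (le_trans ax)// prob_below_le_cdfr. Qed.

Lemma le_quantile x : prob_below F x < a -> x <= quantile F a.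
Proof.
move=> xa; rewrite leNgt; apply: contraPN xa => /(cdfr_le_prob_below F) qx.
by apply/negP; rewrite -leNgt (le_trans _ qx)// le_cdfr_quantile.
Qed.

End quantile.
End law_cdf.

(** * Newsvendor cost *)

Section cost.
Context {R : realType}.
Variables b h M : R.
Hypotheses (b0 : 0 < b) (h0 : 0 < h).
Implicit Types (F G : law R) (q x : R).
Local Notation rho := (rho b h).

Lemma rho_gt0 : 0 < rho.
Proof. by rewrite divr_gt0// addr_gt0. Qed.

Lemma rho_lt1 : rho < 1.
Proof. by rewrite ltr_pdivrMr ?addr_gt0// mul1r ltrDl. Qed.

Lemma mul_rho : (b + h) * rho = b.
Proof. by rewrite /Defs.rho mulrCA divff ?mulr1// gt_eqF// addr_gt0. Qed.

Lemma qstarE F : qstar b h F = quantile F rho.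
Proof. by []. Qed.

Lemma admissible_ge0 F x : admissible b h M F -> x < 0 -> cdfr F x = 0.
Proof.
move=> [F0 _ _] x0; apply/eqP; rewrite eq_le; apply/andP; split; last first.
  by rewrite -lee_fin -cdfrE cdf_ge0.
rewrite (le_trans (cdfr_le_prob_below F x0))// -lee_fin -prob_belowE.
by rewrite F0.
Qed.

Lemma admissible_qstar_ge0 F : admissible b h M F -> 0 <= qstar b h F.
Proof.
move=> aF; rewrite leNgt; apply/negP => /(admissible_ge0 aF).
have := le_cdfr_quantile F rho_lt1; rewrite qstarE => + F0.
by rewrite F0 leNgt rho_gt0.
Qed.

(** The negative half-line is null, so |D| = D almost surely and a finite expectation gives
    integrability. *)
Lemma admissible_Lfun F : admissible b h M F ->
  (demand F : measurableTypeR R -> R) \in Lfun F 1.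
Proof.
move=> [F0 Foo _]; apply/Lfun1_integrable/integrableP; split.
  exact/measurable_EFinP.
move: Foo; rewrite unlock; apply: le_lt_trans.
rewrite le_eqVlt; apply/orP; left; apply/eqP; apply: ae_eq_integral => //.
- by apply: measurableT_comp => //; exact/measurable_EFinP.
- exact/measurable_EFinP.
exists [set w | demand F w < 0]; split => //; first exact: measurable_ltr.
move=> w /= /not_implyP[_] /=; apply: contra_notT; rewrite -leNgt => w0.
by rewrite ger0_norm.
Qed.

Definition newsvendor q x : R := b * Num.max (x - q) 0 + h * Num.max (q - x) 0.

Lemma newsvendor_Lfun F q : admissible b h M F ->
  (newsvendor q : measurableTypeR R -> R) \in Lfun F 1.
Proof.
move=> /admissible_Lfun/Lfun_norm/Lfun1_integrable iF.
have iq := finite_measure_integrable_cst F `|q| measurableT.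
have := integrableZl measurableT (b + h) (integrableD measurableT iF iq).
move=> /le_integrable lei; apply/Lfun1_integrable; apply: lei => //.
  apply/measurable_EFinP; apply: measurable_funD; apply: measurable_funM => //;
    apply: measurable_maxr => //; apply: measurable_funB => //.
move=> x _; rewrite -EFinD -EFinM/= lee_fin ger0_norm; last first.
  by rewrite addr_ge0// mulr_ge0 ?(ltW b0) ?(ltW h0)// le_max lexx orbT.
have t0 : 0 <= `|x| + `|q| by rewrite addr_ge0.
rewrite ger0_norm ?mulr_ge0 ?addr_ge0 ?(ltW b0) ?(ltW h0)// mulrDl.
have xq : `|x - q| <= `|x| + `|q| by exact: ler_normB.
by rewrite lerD// ler_pM2l// ge_max t0 andbT (le_trans _ xq)// ?ler_norm//
  distrC ler_norm.
Qed.

Lemma costE F q : cost b h F q = ('E_F[newsvendor q])%E.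
Proof. by []. Qed.

Lemma cost_fin_num F q : admissible b h M F -> cost b h F q \is a fin_num.
Proof. by move=> aF; rewrite costE expectation_fin_num// newsvendor_Lfun. Qed.

Definition costr F q : R := fine (cost b h F q).

Lemma costrE F q : admissible b h M F -> cost b h F q = (costr F q)%:E.
Proof. by move=> aF; rewrite fineK// cost_fin_num. Qed.

(** Both one-sided cost bounds integrate a pointwise comparison whose error is a constant [k.1] plus
    [k.2] times an indicator. *)
Lemma cost_le_indic F (A : set (measurableTypeR R)) p q c k :
  admissible b h M F -> measurable A -> F A = p%:E ->
  (forall x, newsvendor q x <= newsvendor c x + k.1 + k.2 * \1_A x) ->
  costr F q <= costr F c + k.1 + k.2 * p.
Proof.
move=> aF mA Ap le_qc; rewrite -lee_fin !EFinD EFinM -!(costrE _ aF) -Ap.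
have iA : (\1_A : measurableTypeR R -> R) \in Lfun F 1.
  by apply/Lfun1_integrable; exact: integrable_indic.
have ik : (cst k.1 : measurableTypeR R -> R) \in Lfun F 1 by exact: Lfun_cst.
have iq := newsvendor_Lfun q aF; have ic := newsvendor_Lfun c aF.
have ick : (newsvendor c \+ cst k.1 : measurableTypeR R -> R) \in Lfun F 1.
  exact: rpredD ic ik.
have ikA : (k.2 \o* \1_A : measurableTypeR R -> R) \in Lfun F 1.
  exact: Lfun_scale.
rewrite -(expectation_cst F k.1) -(expectation_indic F mA) -expectationZl//.
rewrite !costE -expectationD// -expectationD//.
rewrite unlock; apply: le_integral => //; [exact/Lfun1_integrable| |].
  by apply/Lfun1_integrable; exact: rpredD ick ikA.
by move=> x _; rewrite lee_fin/= (le_trans (le_qc x))//= mulrC.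
Qed.

Lemma costr_subl F q q' : admissible b h M F -> q <= q' ->
  costr F q - costr F q' <= (q' - q) * (b + h) * (rho - cdfr F q).
Proof.
move=> aF qq'.
(* Passing from q' to q changes the integrand by exactly -h (q' - q) for x <= q and by at most b (q'
   - q) for x > q; the pair encodes this step function. *)
have := @cost_le_indic F [set` `]-oo, q]] _ q q'
  (b * (q' - q), - (b + h) * (q' - q)) aF (measurable_itv _) (law_itvE F q).
move=> /(_ _)/le_trans; rewrite lerBlDl; apply; last first.
  by rewrite /= -addrA lerD2l -{1}mul_rho; lra.
move=> x /=; rewrite /newsvendor indicE; case: (boolP (x \in _)) => xq.
  move: xq; rewrite inE/= in_itv/= => xq.
  have xq' := le_trans xq qq'.
  rewrite (max_r (_ : x - q <= 0)) ?subr_le0// (max_r (_ : x - q' <= 0)) ?subr_le0//.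
  by rewrite !max_l ?subr_ge0//; lra.
move: xq; rewrite notin_setE/= in_itv/= => /negP; rewrite -ltNge => /ltW qx.
rewrite mulr0 addr0 (max_l (_ : 0 <= x - q)) ?subr_ge0//.
rewrite (max_r (_ : q - x <= 0)) ?subr_le0// mulr0 addr0.
have : b * (x - q') <= b * Num.max (x - q') 0 by rewrite ler_pM2l// le_max lexx.
have : 0 <= h * Num.max (q' - x) 0 by rewrite mulr_ge0 ?(ltW b0) ?(ltW h0)// le_max lexx orbT.
by lra.
Qed.

Lemma costr_subr F q q' : admissible b h M F -> q <= q' ->
  costr F q' - costr F q <= (q' - q) * (b + h) * (prob_below F q' - rho).
Proof.
move=> aF qq'.
(* Passing from q to q' changes the integrand by at most h (q' - q) for x < q' and by exactly -b (q'
   - q) for x >= q'. *)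
have := @cost_le_indic F [set w | demand F w < q'] _ q' q
  (- b * (q' - q), (b + h) * (q' - q)) aF (measurable_ltr _) (prob_belowE F q').
move=> /(_ _)/le_trans; rewrite lerBlDl; apply; last first.
  by rewrite /= -addrA lerD2l -{1}mul_rho; lra.
move=> x /=; rewrite /newsvendor indicE; case: (boolP (x \in _)) => xq.
  move: xq; rewrite inE/= => /ltW xq; rewrite /demand_id/= in xq.
  rewrite (max_r (_ : x - q' <= 0)) ?subr_le0// (max_l (_ : 0 <= q' - x)) ?subr_ge0//.
  have : h * (q - x) <= h * Num.max (q - x) 0 by rewrite ler_pM2l// le_max lexx.
  have : 0 <= b * Num.max (x - q) 0 by rewrite mulr_ge0 ?(ltW b0) ?(ltW h0)// le_max lexx orbT.
  by lra.
move: xq; rewrite notin_setE/= => /negP; rewrite -leNgt => xq; rewrite /demand_id/= in xq.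
have xq' := le_trans qq' xq.
rewrite (max_r (_ : q - x <= 0)) ?subr_le0// (max_r (_ : q' - x <= 0)) ?subr_le0//.
by rewrite !max_l ?subr_ge0//; lra.
Qed.

(** Both one-sided bounds are nonpositive at the quantile, as F^- <= [rho] <= F there. *)
Lemma costr_qstar_le F q : admissible b h M F ->
  costr F (qstar b h F) <= costr F q.
Proof.
move=> aF; rewrite -subr_le0; have [qF|/ltW qF] := leP (qstar b h F) q.
  apply: le_trans (costr_subl aF qF) _; rewrite mulr_ge0_le0//.
    by rewrite mulr_ge0 ?subr_ge0// ltW// addr_gt0.
  by rewrite subr_le0 le_cdfr_quantile ?rho_gt0 ?rho_lt1.
apply: le_trans (costr_subr aF qF) _; rewrite mulr_ge0_le0//.
  by rewrite mulr_ge0 ?subr_ge0// ltW// addr_gt0.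
by rewrite subr_le0 prob_below_quantile ?rho_gt0 ?rho_lt1.
Qed.

End cost.

(** * Worst-case regret *)

Lemma law_map (R : realType) (G : law R) (f : R -> R) : measurable_fun setT f ->
  exists F : law R, [/\ forall A, F A = G (f @^-1` A) &
    forall g : R -> \bar R, measurable_fun setT g -> (forall x, 0 <= g x)%E ->
      (\int[F]_x g x = \int[G]_x g (f x))%E].
Proof.
move=> mf; pose X : {RV G >-> measurableTypeR R} :=
  @mfun_Sub _ _ (measurableTypeR R) (measurableTypeR R) f (mem_set mf).
exists (distribution G X); split => // g mg g0.
by rewrite ge0_integral_distribution.
Qed.

Section regret.
Context {R : realType}.
Variables b h M lam : R.
Variable G : law R.
Hypotheses (b0 : 0 < b) (h0 : 0 < h).
Hypotheses (aG : admissible b h M G) (lam0 : 0 <= lam).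
Implicit Types (F : law R) (q x : R).
Local Notation rho := (rho b h).
Local Notation Gm := (prob_below G lam).
Local Notation regret := (regret b h M lam G).
Local Notation ambiguity := (ambiguity b h M lam G).
Local Notation Delta := (minimax_risk b h M lam G).
Local Notation costr := (costr b h).

Lemma regret_le q c :
  (forall F, ambiguity F -> costr F q - costr F (qstar b h F) <= c) ->
  (regret q <= c%:E)%E.
Proof.
move=> qc; apply: ge_ereal_sup => _ [F FG <-]; have [aF _] := FG.
by rewrite !(costrE b0 h0 _ aF) -EFinB lee_fin qc.
Qed.

Lemma regret_ge q F : ambiguity F ->
  ((costr F q - costr F (qstar b h F))%:E <= regret q)%E.
Proof.
move=> FG; have [aF _] := FG; apply: ereal_sup_ubound; exists F => //.
by rewrite !(costrE b0 h0 _ aF) EFinB.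
Qed.

Lemma regret_ge0 q : (0 <= regret q)%E.
Proof.
have GG : ambiguity G by [].
by apply: le_trans (regret_ge q GG); rewrite lee_fin subr_ge0 (costr_qstar_le b0 h0 _ aG).
Qed.

Lemma minimax_risk_ge0 : (0 <= Delta)%E.
Proof. by apply: le_ereal_inf_tmp => _ [q _ <-]; exact: regret_ge0. Qed.

Lemma ambiguity_prob_below F : ambiguity F ->
  forall x, x <= lam -> prob_below F x = prob_below G x.
Proof.
by move=> [_ FG] x xl; apply: eq_prob_below => y yx; rewrite FG// (lt_le_trans yx).
Qed.

(** Each F in the ambiguity set agrees with G below [lam] and has its quantile in [0, lam], so the
    one-sided cost bounds apply with a gap of at most [lam]. The lower condition is asked only for q
    < lam, where F(q) is known; at q = lam the quantile cannot exceed q. *)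
Lemma regret_le_above q e : rho <= Gm -> 0 <= e -> 0 <= q <= lam ->
  (q < lam -> rho - e <= cdfr G q) -> prob_below G q <= rho + e ->
  (regret q <= (lam * (b + h) * e)%:E)%E.
Proof.
move=> rG e0 /andP[q0 ql] lo hi; apply: regret_le => F FG.
have [aF FGx] := FG.
have bh : 0 <= b + h by rewrite addr_ge0 ?ltW.
have qF0 := admissible_qstar_ge0 b0 h0 aF.
have qFl : qstar b h F <= lam.
  rewrite qstarE quantile_le_below ?rho_gt0//.
  by rewrite (ambiguity_prob_below FG).
have lbe : 0 <= lam * (b + h) * e by rewrite !mulr_ge0.
have [qF|/ltW Fq] := leP q (qstar b h F).
  have [ql'|lq] := ltP q lam; last first.
    suff -> : qstar b h F = q by rewrite subrr.
    by apply/eqP; rewrite eq_le qF andbT (le_trans qFl).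
  apply: le_trans (costr_subl b0 h0 aF qF) _.
  have Fe : rho - cdfr F q <= e by rewrite /cdfr FGx// lerBlDr -lerBlDl lo.
  apply: (@le_trans _ _ ((qstar b h F - q) * (b + h) * e)).
    by rewrite ler_wpM2l// mulr_ge0// subr_ge0.
  by rewrite !ler_wpM2r// lerBlDr (le_trans qFl)// lerDl.
apply: le_trans (costr_subr b0 h0 aF Fq) _.
have Fe : prob_below F q - rho <= e.
  by rewrite (ambiguity_prob_below FG)// lerBlDl.
apply: (@le_trans _ _ ((q - qstar b h F) * (b + h) * e)).
  by rewrite ler_wpM2l// mulr_ge0// subr_ge0.
by rewrite !ler_wpM2r// lerBlDr (le_trans ql)// lerDl.
Qed.

(** The true quantile meets the previous bound with e = 0. *)
Lemma minimax_risk_above : rho <= Gm -> Delta = 0%E.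
Proof.
move=> rG; apply/eqP; rewrite eq_le minimax_risk_ge0 andbT.
have qG0 := admissible_qstar_ge0 b0 h0 aG.
have qGl : qstar b h G <= lam by rewrite qstarE quantile_le_below ?rho_gt0.
apply: (@le_trans _ _ (regret (qstar b h G))).
  apply: ereal_inf_lbound; exists (qstar b h G) => //.
  by rewrite /= in_itv/= qG0; case: aG.
have := @regret_le_above (qstar b h G) 0 rG (lexx _).
rewrite qG0 qGl subr0 addr0 mulr0; apply => // [_|].
  by rewrite qstarE le_cdfr_quantile ?rho_lt1.
by rewrite qstarE prob_below_quantile ?rho_gt0.
Qed.

(* The adversarial laws are those of the demand with all values >= lam replaced
   by c, for c = M and c = lam. *)
Lemma tail_atom_law c : Gm < rho -> lam <= c -> c <= M ->
  exists F, [/\ ambiguity F, prob_below F c = Gm, cdfr F c = 1 &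
    qstar b h F = c].
Proof.
move=> Gr lc cM; pose f x := if x < lam then x else c.
have mf : measurable_fun setT f by apply: measurable_fun_ifT => //; exact: measurable_fun_ltr.
have [F [FE Fint]] := law_map G mf.
have c0 := le_trans lam0 lc.
have Fc : prob_below F c = Gm.
  apply: EFin_inj; rewrite -!prob_belowE FE; congr (G _); apply/seteqP.
  split=> x; rewrite /f/=/demand_id/=; case: (ltP x lam) => xl; rewrite ?ltxx//.
  by move=> _; exact: lt_le_trans xl lc.
have F1 : cdfr F c = 1.
  apply: EFin_inj; rewrite -law_itvE FE [X in G X](_ : _ = setT) ?probability_setT//.
  apply/seteqP; split=> x //= _; rewrite in_itv/= /f; case: (ltP x lam) => // xl.
  by rewrite ltW// (lt_le_trans xl).
have qF : qstar b h F = c.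
  apply/eqP; rewrite qstarE eq_le; apply/andP; split.
    by rewrite quantile_le ?rho_gt0// F1 ltW// rho_lt1.
  by rewrite le_quantile ?rho_lt1// Fc.
have FG x : x < lam -> cdf (demand F) x = cdf (demand G) x.
  move=> xl; rewrite !cdfrE -!law_itvE FE; congr (G _); apply/seteqP.
  split=> y; rewrite /f/= !in_itv/=; case: (ltP y lam) => // ly.
    by rewrite leNgt (lt_le_trans xl).
  by move=> yx; have := lt_le_trans xl ly; rewrite ltNge yx.
exists F; split => //; split => //; split; last by rewrite qF.
  rewrite FE; case: aG => G0 _ _; rewrite -G0; congr (G _); apply/seteqP.
  split=> x; rewrite /f/=/demand_id/=; case: (ltP x lam) => // lx; first by rewrite ltNge c0.
  by rewrite ltNge (le_trans lam0).
have iG : (\int[G]_x `|x%:E| < +oo)%E.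
  by have /Lfun1_integrable/integrableP[] := admissible_Lfun aG.
have mE : measurable_fun [set: measurableTypeR R] (fun x : measurableTypeR R => x%:E).
  exact/measurable_EFinP.
have mabs : measurable_fun [set: measurableTypeR R] (fun x : measurableTypeR R => `|x%:E|)%E.
  exact: measurableT_comp.
rewrite unlock (@le_lt_trans _ _ (\int[F]_x `|x%:E|)%E)//.
  by apply: le_trans (lee_abs _) _; exact: le_abse_integral.
(* The modified demand is at most |x| + c in absolute value, which keeps its expectation finite. *)
rewrite Fint//; apply: (@le_lt_trans _ _ (\int[G]_x (`|x%:E| + c%:E))%E).
  apply: ge0_le_integral => //.
  - apply: measurableT_comp mabs _ => //; exact: mf.
  - exact: emeasurable_funD.
  move=> x _; rewrite /f; case: ifP => _; first by rewrite leeDl// lee_fin.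
  by rewrite /= ger0_norm// leeDr.
rewrite ge0_integralD// integral_cst// lte_add_pinfty//.
by rewrite lte_mul_pinfty ?lee_fin// (le_lt_trans (probability_le1 G _)) ?ltry.
Qed.

(** The adversary puts the tail at M. Orders below [lam] are included because the infimum in [Delta]
    ranges over all of [0, M]. *)
Lemma regret_ge_below q : Gm < rho -> lam <= M -> q <= M ->
  (((M - q) * (b + h) * (rho - Gm))%:E <= regret q)%E.
Proof.
move=> Gr lM qM; have [F [FG Fc _ qF]] := tail_atom_law Gr lM (lexx M).
apply: le_trans (regret_ge q FG); rewrite lee_fin qF.
by have [aF _] := FG; have := costr_subr b0 h0 aF qM; rewrite Fc; lra.
Qed.

(** The adversary puts the tail at [lam]; the slope h is (b + h) (1 - rho). *)
Lemma regret_ge_above q : Gm < rho -> lam <= M -> lam <= q ->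
  ((h * (q - lam))%:E <= regret q)%E.
Proof.
move=> Gr lM lq; have [F [FG _ F1 qF]] := tail_atom_law Gr (lexx lam) lM.
apply: le_trans (regret_ge q FG); rewrite lee_fin qF.
have [aF _] := FG; have := costr_subl b0 h0 aF lq; rewrite F1.
by have := mul_rho b0 h0; nra.
Qed.

(** Every F in the ambiguity set has its quantile in [lam, M]. Under-ordering uses F(q) >= G^-(lam),
    over-ordering uses F^-(q) <= 1. *)
Lemma regret_le_below q c : Gm < rho -> lam <= q <= M ->
  (M - q) * (b + h) * (rho - Gm) <= c -> h * (q - lam) <= c ->
  (regret q <= c%:E)%E.
Proof.
move=> Gr /andP[lq qM] c1 c2; apply: regret_le => F FG; have [aF FGx] := FG.
have bh : 0 < b + h by rewrite addr_gt0.
have qFM : qstar b h F <= M by case: aF.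
have Fl : prob_below F lam = Gm by rewrite (ambiguity_prob_below FG).
have lqF : lam <= qstar b h F by rewrite qstarE le_quantile ?rho_lt1// Fl.
have [qF|/ltW Fq] := leP q (qstar b h F).
  apply: le_trans (costr_subl b0 h0 aF qF) (le_trans _ c1).
  have GF : Gm <= cdfr F q.
    by rewrite -Fl (le_trans (prob_below_homo F lq))// prob_below_le_cdfr.
  apply: (@le_trans _ _ ((qstar b h F - q) * (b + h) * (rho - Gm))).
    by rewrite ler_wpM2l ?lerD2l ?lerN2// mulr_ge0 ?subr_ge0// ltW.
  by rewrite ler_wpM2r ?subr_ge0 ?(ltW Gr)// ler_wpM2r ?(ltW bh)// lerD2r.
apply: le_trans (costr_subr b0 h0 aF Fq) (le_trans _ c2).
have -> : h * (q - lam) = (q - lam) * (b + h) * (1 - rho).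
  by have := mul_rho b0 h0; nra.
apply: (@le_trans _ _ ((q - qstar b h F) * (b + h) * (1 - rho))).
  rewrite ler_wpM2l ?mulr_ge0 ?subr_ge0 1?(ltW bh)// lerD2r.
  by rewrite (le_trans (prob_below_le_cdfr F q))// cdfr_le1.
have r0 : 0 <= 1 - rho by rewrite subr_ge0 ltW// rho_lt1.
by rewrite ler_wpM2r// ler_wpM2r ?(ltW bh)// lerD2l lerN2.
Qed.

(** Both worst-case terms at the point computed from g exceed their common value at the true
    equalizer by at most (M - lam) (b + h) z. *)
Lemma regret_le_equalizer g z : Gm < rho -> lam <= M -> g < rho ->
  `|g - Gm| <= z ->
  (regret ((b * M + h * lam - (b + h) * g * M) / ((b + h) * (1 - g))) <=
    Delta + ((M - lam) * (b + h) * z)%:E)%E.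
Proof.
move=> Gr lM gr; rewrite ler_norml => /andP[gz1 gz2].
have bh : 0 < b + h by rewrite addr_gt0.
have r1 := rho_lt1 b0 h0.
have g1 : 0 < 1 - g by lra.
have G1 : 0 < 1 - Gm by lra.
have Ml : 0 <= M - lam by rewrite subr_ge0.
have hE : h = (b + h) * (1 - rho) by have := mul_rho b0 h0; lra.
(* [q0] equalizes the two lower bounds [regret_ge_below] and
   [regret_ge_above], hence their common value there bounds [Delta] below. *)
pose t x := (rho - x) / (1 - x).
pose q0 := lam + t Gm * (M - lam).
set q := (X in regret X).
have shrink u v x : 0 <= u <= 1 -> 0 <= v <= 1 -> x <= z -> u * v * x <= z.
  move=> /andP[u0 u1] /andP[v0 v1] xz.
  have uv0 : 0 <= u * v by rewrite mulr_ge0.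
  have uv1 : u * v <= 1 by rewrite mulr_ile1.
  apply: le_trans (ler_wpM2l uv0 xz) _; rewrite ler_piMl//; lra.
(* Writing b = (b + h) rho and h = (b + h) (1 - rho) cancels b + h: q sits at fraction [t g] of the
   segment from [lam] to M. *)
have qE : q = lam + t g * (M - lam).
  have num : b * M + h * lam - (b + h) * g * M =
      (b + h) * ((rho - g) * M + (1 - rho) * lam).
    transitivity ((b + h) * rho * M + (b + h) * (1 - rho) * lam - (b + h) * g * M).
      by rewrite -hE (mul_rho b0 h0).
    by ring.
  rewrite /q num -mulf_div divff ?gt_eqF// mul1r /t.
  by field; rewrite gt_eqF.
have t01 x : x < rho -> 0 <= t x <= 1.
  move=> xr; have x1 : 0 < 1 - x by rewrite subr_gt0 (lt_trans xr).
  apply/andP; split; first by apply: divr_ge0; lra.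
  by rewrite ler_pdivrMr// mul1r; lra.
have q0E : (M - q0) * (b + h) * (rho - Gm) = h * (q0 - lam).
  by rewrite [X in X * (q0 - _)]hE /q0 /t; field; rewrite gt_eqF.
have vD : ((h * (q0 - lam))%:E <= Delta)%E.
  (* An order to the left of [q0] suffers from the atom at M, one to the right from the atom at
     [lam]. *)
  apply: le_ereal_inf_tmp => _ [x + <-]; rewrite /= in_itv/= => /andP[_ xM].
  have [xq|/ltW qx] := leP x q0.
    apply: le_trans (regret_ge_below Gr lM xM); rewrite lee_fin -q0E.
    by rewrite ler_wpM2r ?subr_ge0 ?(ltW Gr)// ler_wpM2r ?(ltW bh)// lerD2l lerN2.
  have lx : lam <= x by rewrite (le_trans _ qx)// lerDl mulr_ge0//; case/andP: (t01 _ Gr).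
  apply: le_trans (regret_ge_above Gr lM lx); rewrite lee_fin.
  by rewrite ler_wpM2l ?(ltW h0)// lerD2r.
apply: le_trans (leeD2r _ vD); rewrite -EFinD; apply: regret_le_below => //.
- have /andP[t0 t1] := t01 _ gr.
  rewrite qE lerDl mulr_ge0//=.
  by rewrite -lerBrDl ler_piMl.
- rewrite -q0E -lerBlDl.
  (* This rests on [t Gm - t g = (1 - t g) * (g - Gm) / (1 - Gm)]; the factors multiplying g - Gm on
     the right lie in [0, 1]. *)
  have -> : (M - q) * (b + h) * (rho - Gm) - (M - q0) * (b + h) * (rho - Gm) =
      (M - lam) * (b + h) * ((1 - t g) * t Gm * (g - Gm)).
    by rewrite qE /q0 /t; field; rewrite !gt_eqF.
  rewrite ler_wpM2l ?mulr_ge0 ?(ltW bh)//.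
  by apply: shrink; rewrite ?t01//; have := t01 _ gr; lra.
- rewrite -lerBlDl -mulrBr.
  have -> : h * (q - lam - (q0 - lam)) =
      (M - lam) * (b + h) * ((1 - t g) * (1 - t Gm) * (Gm - g)).
    by rewrite [X in X * _]hE qE /q0 /t; field; rewrite !gt_eqF.
  rewrite ler_wpM2l ?mulr_ge0 ?(ltW bh)//.
  by apply: shrink; [have := t01 _ gr; lra|have := t01 _ Gr; lra|lra].
Qed.

End regret.

(** * Hoeffding's inequality for frequencies *)

Section bernoulli_mgf.
Context {R : realType}.

Lemma ge0_of_derive_ge0 (f df : R -> R) (s : R) :
  (forall x, is_derive (x : R) (1 : R) f (df x)) -> f 0 = 0 ->
  (forall x, 0 <= x -> 0 <= df x) -> 0 <= s -> 0 <= f s.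
Proof.
move=> fdf f0 df0 s0; rewrite -f0.
apply: (@ger0_derive1_ndecry _ f 0) => // [x|].
  rewrite in_itv/= andbT => /ltW x0.
  by rewrite derive1E (@derive_val _ _ _ _ _ _ _ (fdf x)) df0.
apply: continuous_subspaceT => x.
by apply: differentiable_continuous; apply/derivable1_diffP; case: (fdf x).
Qed.

(** Hoeffding's lemma for a Bernoulli variable: the logarithmic gap [f] and its derivative [g]
    vanish at 0, and f'' >= 0. *)
Lemma bernoulli_mgf_le (p s : R) : 0 <= p <= 1 -> 0 <= s ->
  p * expR s + (1 - p) <= expR (s * p + s ^+ 2 / 8).
Proof.
move=> /andP[p0 p1] s0.
pose m x := p * expR x + (1 - p).
have m0 x : 0 < m x.
  have := expR_gt0 x; rewrite /m; have [->|pn0 ex] := eqVneq p 0; first lra.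
  have : 0 < p * expR x by rewrite mulr_gt0// lt_def pn0.
  by lra.
have dm x : is_derive (x : R) (1 : R) m (p * expR x).
  by apply: is_derive_eq; rewrite addr0.
pose g x := p + x / 4 - p * expR x / m x.
pose f x := x * p + x ^+ 2 / 8 - ln (m x).
have df x : is_derive (x : R) (1 : R) f (g x).
  have dl : is_derive (x : R) (1 : R) (@ln R \o m) ((m x)^-1 * (p * expR x)).
    exact: (@is_derive1_comp _ (@ln R) m x _ _ (is_derive1_ln (m0 x))).
  apply: is_derive_eq.
  by rewrite /g /GRing.scale/=; field; rewrite gt_eqF.
have dg x : is_derive (x : R) (1 : R) g (4^-1 - p * (1 - p) * expR x / m x ^+ 2).
  have mx0 : m x != 0 by rewrite gt_eqF.
  have dv := is_deriveV mx0 (dm x).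
  apply: is_derive_eq.
  by rewrite /GRing.scale/= /m; field.
suff : 0 <= f s by rewrite subr_ge0 -[leRHS]expRK ler_ln ?posrE ?expR_gt0.
have m00 : m 0 = 1 by rewrite /m expR0; lra.
apply: ge0_of_derive_ge0 df _ _ s0 => [|x x0].
  by rewrite /f m00 ln1 expr0n/=; lra.
apply: ge0_of_derive_ge0 dg _ _ x0 => [|y _].
  by rewrite /g m00 expR0; lra.
rewrite subr_ge0 ler_pdivrMr ?exprn_gt0//.
(* With u = p e^y and v = 1 - p, the goal is 4 u v <= (u + v)^2. *)
suff : 0 <= (p * expR y - (1 - p)) ^+ 2 by rewrite /m; lra.
exact: sqr_ge0.
Qed.

End bernoulli_mgf.

Lemma measure_bigsetU_le d (T : measurableType d) (R : realType)
    (mu : {measure set T -> \bar R}) (I : Type) (r : seq I) (Q : pred I)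
    (B : I -> set T) : (forall i, measurable (B i)) ->
  (mu (\big[setU/set0]_(i <- r | Q i) B i) <= \sum_(i <- r | Q i) mu (B i))%E.
Proof.
move=> mB; elim: r => [|i r IHr]; first by rewrite !big_nil measure0.
rewrite !big_cons; case: ifP => // _.
apply: le_trans (leeD2l _ IHr); apply: measureU2 => //.
exact: bigsetU_measurable.
Qed.

Section hoeffding.
Context {R : realType} {d : measure_display} {Omega : measurableType d}.
Variables (P : probability Omega R) (G : law R) (I : finType).
Variables (D : I -> {RV P >-> R}).
Hypothesis iidD : iid D G.
Variables (A : set (measurableTypeR R)) (p : R).
Hypotheses (mA : measurable A) (GA : G A = p%:E).

Lemma iid_preimage (i : I) B : measurable B -> P (D i @^-1` B) = G B.
Proof. by move=> mB; case: iidD => _ /(_ i B mB). Qed.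

Definition count_in w : R := \sum_i \1_A (D i w).

Let setAC (J : {set I}) i : set R := if i \in J then A else ~` A.

Let m_setAC J i : measurable (setAC J i).
Proof. by rewrite /setAC; case: ifP => // _; exact: measurableC. Qed.

(** Samples with index in J fall in A, all others outside; the intersection over the full index set
    lets independence cover the complements too. *)
Definition cylinder (J : {set I}) : set Omega :=
  \bigcap_(i in [set` [set: I]%SET]) (D i @^-1` setAC J i).

Lemma measurable_cylinder J : measurable (cylinder J).
Proof.
apply: fin_bigcap_measurable; first exact: finite_finset.
by move=> i _; rewrite -[X in measurable X]setTI; exact: measurable_funP.
Qed.

Lemma P_cylinder J :
  P (cylinder J) = (\prod_i (if i \in J then p else 1 - p))%:E.
Proof.
case: (iidD) => indep _; rewrite [LHS]indep//.
rewrite -prodEFin; apply: eq_big => [i|i _]; first by rewrite inE.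
rewrite iid_preimage; last exact: m_setAC.
by rewrite /setAC; case: ifP => // _; rewrite probability_setC// GA.
Qed.

Lemma measurable_count_in : measurable_fun setT count_in.
Proof.
apply: measurable_sum => i; exact: measurableT_comp.
Qed.

Lemma measurable_count_in_ge t : measurable [set w | t <= count_in w].
Proof.
rewrite -[X in measurable X]setTI; have := measurable_count_in.
by move=> /(_ measurableT _ (measurable_itv `[t, +oo[)); rewrite set_itvE.
Qed.

Lemma sub_count_in_ge t : [set w | t <= count_in w] `<=`
  \big[setU/set0]_(J in [pred J : {set I} | t <= #|J|%:R]) cylinder J.
Proof.
move=> w /= tw; rewrite -bigcup_pred.
pose J := [set i | D i w \in A]%SET.
have wJ : count_in w = #|J|%:R.
  rewrite /count_in -sum1_card natr_sum [RHS]big_mkcond/=.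
  by apply: eq_bigr => i _; rewrite indicE inE; case: (_ \in A).
exists J; first by rewrite /= inE -wJ.
move=> i _; rewrite /setAC/= inE; case: ifPn => [|]; first by rewrite inE.
by rewrite notin_setE.
Qed.

(* The event is split according to the set J of the samples that fall in A; by
   independence, J has probability p ^ #|J| (1 - p) ^ (#|I| - #|J|). *)
Lemma chernoff_count_in t s : 0 <= p <= 1 -> 0 <= s ->
  (P [set w | t <= count_in w]%R <=
    (expR (- (s * t)) * (p * expR s + (1 - p)) ^+ #|I|)%:E)%E.
Proof.
move=> /andP[p0 p1] s0.
have mc := measurable_count_in_ge t.
have mU : measurable
    (\big[setU/set0]_(J in [pred J : {set I} | t <= #|J|%:R]) cylinder J).
  by apply: bigsetU_measurable => J _; exact: measurable_cylinder.
apply: le_trans (le_measure P _ _ (sub_count_in_ge (t := t))) _; rewrite ?inE//.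
apply: le_trans (measure_bigsetU_le P _ _ measurable_cylinder) _.
rewrite (eq_bigr _ (fun J _ => P_cylinder J)) sumEFin lee_fin.
pose f (J : {set I}) := \prod_i (if i \in J then p else 1 - p).
have f0 J : 0 <= f J by apply: prodr_ge0 => i _; case: ifP => // _; rewrite subr_ge0.
(* Exponential Markov step: the indicator of t <= |J| is at most exp(s (|J| - t)). *)
apply: (@le_trans _ _ (\sum_(J : {set I}) expR (s * (#|J|%:R - t)) * f J)).
  rewrite big_mkcond/=; apply: ler_sum => J _; case: ifPn => [tJ|_].
    rewrite ler_peMl ?f0// -[leLHS]expR0 ler_expR mulr_ge0// subr_ge0.
    by rewrite inE in tJ.
  by rewrite mulr_ge0 ?f0// expR_ge0.
have -> : (p * expR s + (1 - p)) ^+ #|I| = \prod_(i : I) (p * expR s + (1 - p)).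
  by rewrite prodr_const.
(* The product of sums expands over the subsets J, after which the two sides agree term by term. *)
rewrite bigA_distr mulr_sumr; apply: ler_sum => J _.
rewrite mulrBr expRD [X in X <= _]mulrAC [expR (s * _) * f J]mulrC.
rewrite [leLHS]mulrC ler_pM2l ?expR_gt0//.
rewrite mulrC expRM_natr -prodr_const [X in X * _]big_mkcond -big_split/=.
by rewrite le_eqVlt; apply/orP; left; apply/eqP; apply: eq_bigr => i _;
  case: ifP => _; rewrite ?mul1r// mulrC.
Qed.

(** Lower deviations follow by applying this to the complement of A. *)
Lemma hoeffding_count_in z : 0 <= p <= 1 -> 0 <= z ->
  (P [set w | #|I|%:R * (p + z) <= count_in w]%R <=
    (expR (- (2 * #|I|%:R * z ^+ 2)))%:E)%E.
Proof.
move=> p01 z0.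
(* [s = 4 z] minimizes [s ^ 2 / 8 - s z]. *)
have s0 : 0 <= 4 * z by rewrite mulr_ge0.
apply: le_trans (chernoff_count_in _ p01 s0) _; rewrite lee_fin.
have m0 : 0 <= p * expR (4 * z) + (1 - p).
  case/andP: p01 => p0 p1; rewrite addr_ge0 ?subr_ge0// mulr_ge0// expR_ge0.
apply: le_trans (ler_wpM2l (expR_ge0 _) (lerXn2r #|I| _ _ (bernoulli_mgf_le p01 s0))) _.
- by rewrite nnegrE.
- by rewrite nnegrE expR_ge0.
by rewrite -expRM_natl -expRD ler_expR; lra.
Qed.

End hoeffding.

(** * The censored empirical quantile *)

Section empirical_quantile.
Context {R : realType}.
Variables (N : nat) (y : 'I_N -> R) (lam r : R).
Hypotheses (N0 : (0 < N)%N) (r0 : 0 < r) (r1 : r <= 1).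
Hypotheses (y0 : forall i, 0 <= y i) (lam0 : 0 <= lam).

Let s i := Num.min (y i) lam.
Let S := [set x | r <= emp_cdf s x].

Let n0 : 0 < N%:R :> R.
Proof. by rewrite ltr0n. Qed.

Lemma emp_belowE :
  emp_below s lam = N%:R^-1 * \sum_i \1_[set x | x < lam] (y i).
Proof.
congr (_ * _); apply: eq_bigr => i _; rewrite indicE /s gt_min ltxx orbF.
by rewrite (_ : (_ \in _) = (y i < lam)) //; apply/idP/idP; rewrite inE.
Qed.

Let emp_cdfE x : x < lam ->
  emp_cdf s x = N%:R^-1 * \sum_i \1_[set t | t <= x] (y i).
Proof.
move=> xl; congr (_ * _); apply: eq_bigr => i _.
rewrite indicE /s ge_min [lam <= x]leNgt xl orbF.
by rewrite (_ : (_ \in _) = (y i <= x)) //; apply/idP/idP; rewrite inE.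
Qed.

(** All censored samples are at most [lam], so the empirical cdf is 1 there and [S] is nonempty. *)
Let Slam : S lam.
Proof.
rewrite /S/= /emp_cdf (eq_bigr (fun=> 1)) ?sumr_const ?card_ord.
  by rewrite mulVf ?gt_eqF.
by move=> i _; rewrite /s ge_min lexx orbT.
Qed.

Let Sge0 x : S x -> 0 <= x.
Proof.
move=> Sx; rewrite leNgt; apply/negP => x0; move: Sx.
rewrite /S/= /emp_cdf big1 ?mulr0 => [|i _]; first by rewrite leNgt r0.
by rewrite /s ge_min !leNgt (lt_le_trans x0)//= (lt_le_trans x0).
Qed.

Let Slb : has_lbound S.
Proof. by exists 0 => x /Sge0. Qed.

Lemma emp_quantile_bounds : 0 <= inf S <= lam.
Proof.
apply/andP; split; last exact: ge_inf.
by apply: lb_le_inf; [exists lam|exact: Sge0].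
Qed.

Variable G : law R.

(** If G(inf S) < a, some x in [S] lies below both [lam] and the a-quantile; the samples at most x,
    at least N r of them, are then too many below the quantile. *)
Lemma emp_quantile_cdfr_ge a : a < 1 ->
  (0 < a -> \sum_i \1_[set x | x < quantile G a] (y i) < N%:R * r) ->
  inf S < lam -> a <= cdfr G (inf S).
Proof.
move=> a1 few Sl; have [a0|a0] := leP a 0.
  by rewrite (le_trans a0)// -lee_fin -cdfrE cdf_ge0.
rewrite leNgt; apply/negP => /lt_quantile-/(_ a1) Sq.
have S0 : S !=set0 by exists lam.
have /(inf_lt S0)[x Sx] : inf S < Num.min lam (quantile G a).
  by rewrite lt_min Sl Sq.
rewrite lt_min => /andP[xl xq].
move: Sx; rewrite /S/= emp_cdfE// ler_pdivlMl// leNgt => /negP; apply.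
apply: le_lt_trans (few a0); apply: ler_sum => i _; rewrite !indicE.
case: (boolP (y i \in [set t | t <= x])) => //; rewrite inE/= => yx.
by rewrite mem_set//= (le_lt_trans yx).
Qed.

(** If G^-(inf S) > a, the a-quantile lies strictly below inf S, hence outside [S], so more than N
    (1 - r) samples exceed it. *)
Lemma emp_quantile_below_le a : 0 < a ->
  (a < 1 -> \sum_i \1_[set x | quantile G a < x] (y i) < N%:R * (1 - r)) ->
  prob_below G (inf S) <= a.
Proof.
move=> a0 few; have [a1|a1] := leP 1 a.
  rewrite (le_trans _ a1)// (le_trans (prob_below_le_cdfr G _))//.
  exact: cdfr_le1.
rewrite leNgt; apply/negP => aS.
have qS : quantile G a < inf S.
  rewrite ltNge; apply/negP => /(prob_below_homo G).
  by move=> /le_trans/(_ (prob_below_quantile G a0)); rewrite leNgt aS.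
have ql : quantile G a < lam.
  by rewrite (lt_le_trans qS)//; case/andP: emp_quantile_bounds.
have : ~ S (quantile G a) by move=> /(ge_inf Slb); rewrite leNgt qS.
rewrite /S/= emp_cdfE// ler_pdivlMl//; apply.
have sumC : \sum_i \1_[set t | t <= quantile G a] (y i) +
    \sum_i \1_[set x | quantile G a < x] (y i) = N%:R :> R.
  rewrite -big_split/= -[in RHS](card_ord N) -sum1_card natr_sum.
  apply: eq_bigr => i _; rewrite !indicE.
  have [yq|yq] := leP (y i) (quantile G a).
    by rewrite mem_set// memNset ?addr0//=; apply/negP; rewrite -leNgt.
  by rewrite memNset ?mem_set ?add0r//=; apply/negP; rewrite -ltNge.
by have := few a1; lra.
Qed.

End empirical_quantile.

(** * The high-probability event *)

Lemma fine_probability_setC d (T : measurableType d) (R : realType)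
    (P : probability T R) (B : set T) : measurable B ->
  fine (P (~` B)) = 1 - fine (P B).
Proof. by move=> mB; rewrite probability_setC// fineB ?fin_num_measure. Qed.

Section good_event.
Context {R : realType} {d : measure_display} {Omega : measurableType d}.
Variables (P : probability Omega R) (G : law R) (N : nat).
Variables (D : 'I_N -> {RV P >-> R}) (delta : R).
Hypotheses (iidD : iid D G) (N0 : (0 < N)%N).
Hypotheses (delta0 : 0 < delta) (delta1 : delta < 1).

Let zeta := Num.sqrt (ln (2 / delta) / (2 * N%:R)).

Lemma confidence_ge0 : 0 <= zeta.
Proof. exact: sqrtr_ge0. Qed.

Lemma expR_confidence : expR (- (2 * N%:R * zeta ^+ 2)) = delta / 2.
Proof.
have n0 : 0 < 2 * N%:R :> R by rewrite mulr_gt0 ?ltr0n.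
have d2 : 1 <= 2 / delta.
  by rewrite ler_pdivlMr// mul1r (le_trans (ltW delta1))// ler1n.
rewrite sqr_sqrtr; last by rewrite divr_ge0 ?ln_ge0// ltW.
rewrite [X in - X]mulrC divfK ?gt_eqF// expRN lnK ?posrE ?divr_gt0//.
by rewrite invf_div.
Qed.

Definition overcounted (A : set (measurableTypeR R)) : set Omega :=
  [set w | N%:R * (fine (G A) + zeta) <= count_in D A w].

Lemma overcounted_le A : measurable A ->
  (P (overcounted A) <= (delta / 2)%:E)%E.
Proof.
move=> mA; have GA : G A = (fine (G A))%:E by rewrite fineK// fin_num_measure.
have GA01 : 0 <= fine (G A) <= 1.
  by rewrite fine_ge0//= -lee_fin -GA probability_le1.
have := hoeffding_count_in iidD mA GA GA01 confidence_ge0.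
by rewrite card_ord expR_confidence.
Qed.

Lemma measurable_overcounted A : measurable A -> measurable (overcounted A).
Proof. by move=> mA; exact: measurable_count_in_ge. Qed.

(** Union bound over four deviations of probability at most delta/2 each. The null event of a
    negative sample is removed too, so that the empirical quantile is nonnegative. *)
Lemma good_event_exists (A : 'I_4 -> set (measurableTypeR R)) :
  (forall k, measurable (A k)) -> G [set x | x < 0] = 0%E ->
  exists E : set Omega, [/\ measurable E, ((1 - 2 * delta)%:E <= P E)%E &
    forall w, E w -> (forall i, 0 <= D i w) /\
      forall k, count_in D (A k) w < N%:R * (fine (G (A k)) + zeta)].
Proof.
move=> mA Gneg.
pose B0 := \big[setU/set0]_(i < N) (D i @^-1` [set x | x < 0]).
pose B1 := \big[setU/set0]_(k < 4) overcounted (A k).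
have mneg i : measurable (D i @^-1` [set x | x < 0]).
  by rewrite -[X in measurable X]setTI; apply: measurable_funP => //; exact: measurable_ltr.
have mB0 : measurable B0 by exact: bigsetU_measurable.
have mB1 : measurable B1.
  by apply: bigsetU_measurable => k _; exact: measurable_overcounted.
have PB0 : (P B0 <= 0)%E.
  apply: le_trans (measure_bigsetU_le P _ _ mneg) _.
  by rewrite big1// => i _; exact: etrans (iid_preimage iidD i (measurable_ltr 0)) Gneg.
have PB1 : (P B1 <= (2 * delta)%:E)%E.
  apply: le_trans (measure_bigsetU_le P _ _ (fun k => measurable_overcounted (mA k))) _.
  apply: (@le_trans _ _ (\sum_(k < 4) (delta / 2)%:E)%E).
    by apply: lee_sum => k _; exact: overcounted_le.
  by rewrite sumEFin lee_fin sumr_const card_ord; lra.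
exists (~` (B0 `|` B1)); split.
- by apply: measurableC; exact: measurableU.
- rewrite probability_setC; last exact: measurableU.
  have PB : (P (B0 `|` B1) <= (2 * delta)%:E)%E.
    by rewrite -[leRHS]add0e; exact: le_trans (measureU2 _ mB0 mB1) (leeD PB0 PB1).
  by rewrite EFinB leeB.
have sub_big n (F : 'I_n -> set Omega) k : F k `<=` \big[setU/set0]_(j < n) F j.
  by move=> w Fw; rewrite -(bigcup_pred xpredT); exists k.
move=> w /not_orP[nB0 nB1]; split=> [i|k].
  by rewrite leNgt; apply/negP => Dneg; apply: nB0; exact: (sub_big _ _ i).
by rewrite ltNge; apply/negP => Aover; apply: nB1; exact: (sub_big _ _ k).
Qed.

End good_event.

(** * Regret guarantee in the four regimes *)

Unset Implicit Arguments.
Set Strict Implicit.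
Set Printing Implicit Defensive.

Theorem theorem2 (R : realType) (b h M : R) (G : law R) (lam delta : R) (N : nat)
    (d : measure_display) (Omega : measurableType d) (P : probability Omega R)
    (D : 'I_N -> {RV P >-> R}) :
  0 < b -> 0 < h -> 0 <= M ->
  admissible b h M G ->
  0 <= lam ->
  (prob_below G lam < rho b h -> lam < M) ->
  0 < delta -> delta < 1 ->
  (1 <= N)%N ->
  iid D G ->
  let zeta := Num.sqrt (ln (2 / delta) / (2 * N%:R)) in
  let r := rho b h in
  let Gm := prob_below G lam in
  let Regret := regret b h M lam G in
  let Delta := minimax_risk b h M lam G in
  (r <= Gm -> Delta = 0%E) /\
  exists E : set Omega,
    [/\ measurable E,
        ((1 - 2 * delta)%:E <= P E)%E &
        forall w, E w ->
          let q := rcn b h M lam zeta (fun i => Num.min (D i w) lam) in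
          [/\ r + 2 * zeta <= Gm ->
                (Regret q <= Delta + (lam * (b + h) * zeta)%:E)%E,
              r <= Gm < r + 2 * zeta ->
                (Regret q <= Delta + (2 * lam * (b + h) * zeta)%:E)%E,
              r - 2 * zeta <= Gm < r ->
                (Regret q <= Delta + (2 * Num.max (b / h) 1 * (M - lam)
                                        * (b + h) * zeta)%:E)%E &
              Gm < r - 2 * zeta ->
                (Regret q <= Delta + (Num.max (b / h) 1 * (M - lam)
                                        * (b + h) * zeta)%:E)%E]].
Proof.
move=> b0 h0 M0 aG lam0 lamM delta0 delta1 N0 iidD zeta r Gm Regret Delta.
split; first exact: minimax_risk_above.
have r0 : 0 < r by exact: rho_gt0.
have r1 : r < 1 by exact: rho_lt1.
have z0 : 0 < zeta.
  by rewrite sqrtr_gt0 divr_gt0 ?mulr_gt0 ?ltr0n// ln_gt0// ltr_pdivlMr//; lra.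
have n0 : 0 < N%:R :> R by rewrite ltr0n.
have bh : 0 < b + h by rewrite addr_gt0.
pose A (k : 'I_4) : set (measurableTypeR R) := nth set0
  [:: [set x | x < lam]; ~` [set x | x < lam];
      [set x | x < quantile G (r - zeta)];
      ~` [set` `]-oo, quantile G (r + zeta)]]] k.
have mA k : measurable (A k).
  have [k4|] := ltnP k 4; last by rewrite leqNgt ltn_ord.
  case: k {k4} => -[|[|[|[|//]]]] ? /=.
  - exact: measurable_ltr.
  - by apply: measurableC; exact: measurable_ltr.
  - exact: measurable_ltr.
  - by apply: measurableC; exact: measurable_itv.
have Gneg : G [set x | x < 0] = 0%E by case: aG.
have [E [mE PE goodE]] := good_event_exists iidD N0 delta0 delta1 mA Gneg.
exists E; split => // w /goodE[D0 good] q.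
pose y i := D i w.
pose cnt (B : set R) := \sum_i \1_B (y i) : R.
have cntC B : cnt (~` B) = N%:R - cnt B.
  apply/eqP; rewrite eq_sym subr_eq -big_split/= -[in X in X == _](card_ord N) -sum1_card natr_sum.
  apply/eqP; apply: eq_bigr => i _; rewrite !indicE in_setC.
  by case: (_ \in B); rewrite ?add0r ?addr0.
set g := emp_below (fun i => Num.min (y i) lam) lam.
have gE : N%:R * g = cnt [set x | x < lam].
  by rewrite /g emp_belowE mulrA mulfV ?mul1r// gt_eqF.
have gGm : `|g - Gm| <= zeta.
  have /= lo := good (@Ordinal 4 1 isT); have /= hi := good (@Ordinal 4 0 isT).
  have {}hi : N%:R * g < N%:R * (Gm + zeta) by rewrite gE.
  have {}lo : N%:R - N%:R * g < N%:R * (1 - Gm + zeta).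
    by rewrite gE -cntC -(fine_probability_setC G (measurable_ltr lam)).
  rewrite ltr_pM2l// in hi.
  have {}lo : N%:R * (1 - g) < N%:R * (1 - Gm + zeta) by rewrite mulrBr mulr1.
  by rewrite ltr_pM2l// in lo; rewrite ler_norml; lra.
(* The mass below this quantile is at most r - zeta, so with deviation zeta fewer than N r samples
   fall there. *)
have few2 : 0 < r - zeta -> cnt [set x | x < quantile G (r - zeta)] < N%:R * r.
  move=> rz0; have /= few := good (@Ordinal 4 2 isT).
  apply: lt_le_trans few _; rewrite ler_pM2l// -lerBrDr.
  exact: prob_below_quantile.
(* Dually, the mass above this quantile is at most 1 - r - zeta. *)
have few3 : r + zeta < 1 -> cnt [set x | quantile G (r + zeta) < x] < N%:R * (1 - r).
  move=> rz1; have /= few := good (@Ordinal 4 3 isT).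
  have -> : [set x | quantile G (r + zeta) < x] =
      ~` [set` `]-oo, quantile G (r + zeta)]].
    by apply/seteqP; split=> x /=; rewrite in_itv/= ltNge => /negP.
  apply: lt_le_trans few _; rewrite ler_pM2l// fine_probability_setC//.
  rewrite -lerBrDr -addrA -opprD lerD2l lerN2.
  exact: le_cdfr_quantile.
move: (gGm); rewrite ler_norml => /andP[gz1 gz2].
have qE : q = if r + zeta <= g then
    inf [set x | r <= emp_cdf (fun i => Num.min (y i) lam) x]
  else if g < r - zeta then
    (b * M + h * lam - (b + h) * g * M) / ((b + h) * (1 - g))
  else lam by [].
have Dge0 : (0 <= Delta)%E by exact: minimax_risk_ge0.
have above c : (Regret q <= c%:E)%E -> (Regret q <= Delta + c%:E)%E.
  by move=> /le_trans; apply; rewrite leeDr.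
have rz1 : r - zeta < 1 by rewrite (lt_trans _ r1)// ltrBlDr ltrDl.
have rz0 : 0 < r + zeta by rewrite addr_gt0.
have branch1 : r <= Gm -> r + zeta <= g ->
    (Regret q <= (lam * (b + h) * zeta)%:E)%E.
  move=> rG rg; rewrite qE rg; apply: regret_le_above => //.
  - exact: ltW.
  - exact: (emp_quantile_bounds N0 r0 (ltW r1) D0 lam0).
  - by apply: (emp_quantile_cdfr_ge N0 (ltW r1) rz1 few2).
  - exact: (emp_quantile_below_le N0 r0 (ltW r1) D0 lam0 rz0 few3).
have m1 : 1 <= Num.max (b / h) 1 by rewrite le_max lexx orbT.
(* The equalizer bound holds with factor 1; a larger c only weakens it. *)
have branch2 c : 1 <= c -> Gm < r -> g < r - zeta ->
    (Regret q <= Delta + (c * (M - lam) * (b + h) * zeta)%:E)%E.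
  move=> c1 Gr gr; have lM : lam <= M by exact/ltW/lamM.
  have gr' : g < r by lra.
  have rgF : (r + zeta <= g) = false by rewrite leNgt (lt_trans gr') ?ltrDl.
  rewrite qE rgF gr.
  apply: le_trans (regret_le_equalizer b0 h0 aG lam0 Gr lM gr' gGm) _.
  by rewrite leeD2l// lee_fin -!mulrA ler_peMl// mulr_ge0 ?subr_ge0// mulr_ge0 ?(ltW bh) ?(ltW z0).
(* At q = lam the over-ordering term vanishes and the other is at most 2 (M - lam) (b + h) zeta. *)
have branch3 c : 2 <= c -> Gm < r -> r - 2 * zeta <= Gm -> q = lam ->
    (Regret q <= Delta + (c * (M - lam) * (b + h) * zeta)%:E)%E.
  move=> c2 Gr rG qlam; have lM : lam <= M by exact/ltW/lamM.
  apply: above; rewrite qlam; apply: regret_le_below => //; rewrite ?lexx ?lM ?subrr ?mulr0//.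
    have Mb : 0 <= (M - lam) * (b + h) by rewrite mulr_ge0 ?subr_ge0// ltW.
    have -> : c * (M - lam) * (b + h) * zeta = (M - lam) * (b + h) * (c * zeta).
      by ring.
    rewrite ler_wpM2l//; apply: (@le_trans _ _ (2 * zeta)); first by rewrite lerBlDl -lerBlDr.
    by rewrite ler_pM2r.
  by rewrite !mulr_ge0 ?subr_ge0 ?(ltW bh) ?(ltW z0)// (le_trans _ c2).
have branch3E : ~~ (r + zeta <= g) -> ~~ (g < r - zeta) -> q = lam.
  by move=> /negbTE g1 /negbTE g2; rewrite qE g1 g2.
(* Since |g - Gm| <= zeta, case (i) forces the first branch and case (iv) the second; case (ii)
   rules out the second branch and case (iii) the first. *)
split.
- by move=> rG; apply/above/branch1; lra.
- move=> /andP[rG Gr]; apply: above.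
  have -> : 2 * lam * (b + h) * zeta = lam * (b + h) * (2 * zeta) by ring.
  have [rg|rg] := boolP (r + zeta <= g).
    apply: le_trans (branch1 rG rg) _; rewrite lee_fin.
    rewrite ler_wpM2l ?mulr_ge0 ?(ltW bh)//; lra.
  rewrite branch3E// -?leNgt; last by lra.
  apply: regret_le_above => //; rewrite ?lexx ?lam0 ?ltxx//; last exact: ltW.
  by rewrite mulr_ge0 ?(ltW z0).
- move=> /andP[rG Gr]; have [gr|gr] := boolP (g < r - zeta).
    by apply: branch2 => //; lra.
  by apply: branch3 => //; [lra|apply: branch3E => //; rewrite -ltNge; lra].
- by move=> Gr; apply: branch2 => //; lra.
Qed.
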